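(* For any constant integer $r\geq 2$, a $(2,r)$-ruling set of an $n$-vertex graph with maximum degree $\Delta$ can be computed deterministically in the \textsf{CONGEST} model in $O(\Delta^{2/(r+2)})+\log^* n$ rounds.
   Context: For an integer $r\geq1$, a $(2,r)$-ruling set of a graph $G=(V,E)$ is a set $S\subseteq V$ that is independent in $G$ and such that every vertex $v\in V$ is within hop distance at most $r$ of some vertex of $S$. The \textsf{CONGEST} model: synchronous rounds on the network graph, each vertex may send one $O(\log n)$-bit message per neighbor per round; vertices have unique $O(\log n)$-bit identifiers; at the end each vertex knows whether it belongs to $S$. $\log^* n$ is the iterated logarithm. *)

(* Defs.v *)
From mathcomp Require Import all_boot all_order all_algebra.
From mathcomp Require Import reals exp.

Set Implicit Arguments.
Unset Strict Implicit.
Unset Printing Implicit Defensive.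

Import Order.TTheory GRing.Theory Num.Theory.

(** * Graphs: a symmetric irreflexive [e : rel V] on a [V : finType] *)

Definition simple_graph (V : finType) (e : rel V) : Prop :=
  symmetric e /\ irreflexive e.

Definition max_degree (V : finType) (e : rel V) : nat :=
  \max_(v : V) #|[set u | e v u]|.

Definition within_hops (V : finType) (e : rel V) (r : nat) (u v : V) : Prop :=
  exists p : seq V, [/\ path e u p, last u p = v & size p <= r].

Definition independent (V : finType) (e : rel V) (S : {set V}) : Prop :=
  {in S &, forall u v, ~~ e u v}.

Definition ruling_set2 (V : finType) (e : rel V) (r : nat) (S : {set V}) : Prop :=
  independent e S /\ forall v : V, exists2 s, s \in S & within_hops e r s v.

(** * The CONGEST model

   A deterministic algorithm whose messages are bit strings of length at most
   [b] (sending the empty string amounts to sending nothing).  Local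
   computation is free, so the components are arbitrary functions.  A vertex
   initially knows its identifier and its degree; its neighbours are only
   accessible through local ports [0, ..., degree - 1].  A vertex whose
   [output] is [None] has not decided yet.  That all vertices know [n] and
   [Delta] is expressed by a family of algorithms indexed by [n] and [Delta],
   which uses [b = O(log n)] and must work for all graphs, identifiers and port
   numberings with these parameters. *)
Record congest_algorithm (b : nat) := CongestAlgorithm {
  state : Type;
  init : nat -> nat -> state;  (* identifier, degree *)
  send : state -> nat -> b.-bseq bool;  (* message sent through a port *)
  receive : state -> seq (b.-bseq bool) -> state;  (* messages, in port order *)
  output : state -> option bool
}.

(** [ports v] lists the neighbours of [v]: the [i]-th one is behind port [i].
   The numberings at different vertices are unrelated. *)
Definition port_numbering (V : finType) (e : rel V) (ports : V -> seq V) : Prop :=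
  forall v, uniq (ports v) /\ (forall u, (u \in ports v) = e v u).

(** Unique identifiers of [c * ceil(log2 n)] bits. *)
Definition identifiers (c : nat) (V : finType) (id : V -> nat) : Prop :=
  injective id /\ (forall v, id v < 2 ^ (c * up_log 2 #|V|)).

(** The states after [t] synchronous rounds.  What [v] receives from its
   neighbour [u] is what [u] sends through the port of [u] that leads to [v]. *)
Fixpoint run (b : nat) (A : congest_algorithm b) (V : finType)
    (ports : V -> seq V) (id : V -> nat) (t : nat) : V -> state A :=
  if t is t'.+1 then
    let st := run A ports id t' in
    fun v => receive (st v)
      [seq send (st u) (index v (ports u)) | u <- ports v]
  else fun v => init A (id v) (size (ports v)).

(** Decisions are irrevocable, so that a vertex that has decided knows its
   output, and all vertices have decided within [T] rounds. *)
Definition computes_in (b : nat) (A : congest_algorithm b) (V : finType)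
    (ports : V -> seq V) (id : V -> nat) (T : nat) (S : {set V}) : Prop :=
  (forall t v x, output (run A ports id t v) = Some x ->
                 output (run A ports id t.+1 v) = Some x) /\
  (forall v, output (run A ports id T v) = Some (v \in S)).

(** * The iterated logarithm *)

Local Open Scope ring_scope.

Definition log2 (R : realType) (x : R) : R := ln x / ln 2.

Lemma log_star_subproof (R : realType) (n : nat) :
  exists k, iter k (@log2 R) n%:R <= 1.
Proof.
pose tower k := iter k (expn 2) 1%N.
have tower_gt k : (k < tower k)%N.
  elim: k => //= k IH; apply: leq_ltn_trans (IH) _.
  exact: ltn_expl.
have ln2 : 0 < ln 2 :> R by rewrite ln_gt0 // ltr1n.
have le_tower k : forall x : R, x <= (tower k)%:R -> iter k (@log2 R) x <= 1.
  elim: k => [|k IH] x //= xk; rewrite -[log2 _]/(iter k.+1 (@log2 R) x) iterSr.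
  apply: IH; rewrite /log2 ler_pdivrMr //.
  have [x_gt0|x_le0] := ltP 0 x; last first.
    by rewrite ln0 // mulr_ge0 ?ler0n ?ltW.
  have := xk; rewrite -ler_ln ?posrE ?ltr0n ?expn_gt0 // natrX lnXn //.
  by rewrite mulr_natl.
by exists n; apply: le_tower; rewrite ler_nat ltnW.
Qed.

(** The least number of applications of [log2] that brings [n] down to at
   most 1. *)
Definition log_star (R : realType) (n : nat) : nat :=
  ex_minn (log_star_subproof R n).

(* Main.v *)
(** Linial's color reduction, on curves of low degree over the field with [2^k]
   elements, gives in [log* n] rounds a proper coloring with poly(Delta) colors.
   Write [g = Delta^(1/(r+2))].  Trying the points of its curve one after the
   other, every vertex chooses within [O(g^2)] rounds one of [O(g^2)] classes,
   such that it conflicts with at most [Delta/g^2] neighbours when it chooses: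
   conflicts over the rounds add up to [O(Delta)].  The classes are then handled
   one after the other.  A vertex shifts its curve in a grid of side [O(g^r)] to
   one of the translates with the fewest points taken by neighbours, and picks a
   free point that avoids the curves of its [Delta/g^2 <= g^r] out-neighbours in
   the class; [r >= 2] is used to bound the number [Delta/g^r <= g^2] of taken
   points.  This is a proper coloring with [O(g^(2r))] colors, hence with [r]
   digits in base [O(g^2)].  The digits are used one by one: a vertex leaves if a
   neighbour with a smaller digit stays, so that each digit costs one hop and
   [O(g^2)] rounds, and the vertices that stay until the end are independent. *)

Require Import Defs.
From mathcomp Require Import all_boot all_order all_algebra.
From mathcomp Require Import all_field zify.
From mathcomp Require Import reals exp.
Import Order.TTheory GRing.Theory Num.Theory.

Set Implicit Arguments.
Unset Strict Implicit.
Unset Printing Implicit Defensive.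

(** * Translated low-degree curves in a grid over the field with [2 ^ k] elements *)

Definition grid_field (k : nat) : finFieldType :=
  s2val (pPrimePowerField (p := 2) (isT : prime 2) (ltn0Sn k.-1)).

(** The exponent [k.-1.+1] makes [grid_field] total; it equals [k] only for positive [k]. *)
Lemma card_grid_field k : 0 < k -> #|grid_field k| = 2 ^ k.
Proof.
by move=> k_gt0; rewrite /grid_field (s2valP' (pPrimePowerField _ _)) prednK.
Qed.

Section Curves.

Variables (k N : nat).
Hypothesis k_gt0 : 0 < k.
Let q := 2 ^ k.
Let F := grid_field k.

Definition point (x : nat) : grid_field k := nth 0%R (enum (grid_field k)) x.

Definition coord (y : grid_field k) : nat := index y (enum (grid_field k)).

(** The appended 1 fixes the degree to [N.+1], so that no curve is constant. The factor ['X] removes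
    the constant term, so that the polynomials of two distinct colors never differ by a constant. *)
Definition curve_poly (i : nat) : {poly grid_field k} :=
  (Poly (rcons (nth [tuple of nseq N 0] (enum {: N.-tuple (grid_field k)}) i) 1)
   * 'X)%R.

(** Curves of different colors meet in few points whatever their translations
   [b] are, since the difference of the polynomials of two colors is not
   constant. *)
Definition curve (i b x : nat) : nat :=
  coord (point b + (curve_poly i).[point x])%R.

Lemma size_enum_field : size (enum F) = q.
Proof. by rewrite -cardE card_grid_field. Qed.

Lemma coord_lt y : coord y < q.
Proof. by rewrite -size_enum_field index_mem mem_enum. Qed.

Lemma curve_lt i b x : curve i b x < 2 ^ k.
Proof. exact: coord_lt. Qed.

Lemma coordK : cancel coord point.
Proof. by move=> y; rewrite /point nth_index // mem_enum. Qed.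

Lemma point_inj : {in gtn q &, injective point}.
Proof.
move=> x y xq yq /eqP; rewrite /point nth_uniq ?size_enum_field ?enum_uniq //.
by move/eqP.
Qed.

Lemma count_point_inj (P : pred F) (n : nat) :
  (forall rs : seq F, all P rs -> uniq rs -> size rs <= n) ->
  count (P \o point) (iota 0 q) <= n.
Proof.
move=> Pn; rewrite -size_filter -(size_map point); apply: Pn.
  by rewrite all_map filter_all.
rewrite map_inj_in_uniq ?filter_uniq ?iota_uniq // => x y.
rewrite !mem_filter !mem_iota /= => /andP[_ xq] /andP[_ yq].
exact: point_inj.
Qed.

Lemma count_roots (p : {poly F}) :
  p != 0%R -> size p <= N.+2 ->
  count (fun x => p.[point x] == 0)%R (iota 0 q) <= N.+1.
Proof.
move=> p0 sp; apply: (@count_point_inj (fun z => p.[z] == 0)%R) => rs rsP urs.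
by rewrite -ltnS (leq_trans _ sp) // max_poly_roots.
Qed.

Lemma polyseq_curve (t : seq F) : Poly (rcons t 1%R) = rcons t 1%R :> seq F.
Proof. by apply: (@PolyK _ 0%R); rewrite last_rcons oner_neq0. Qed.

Lemma size_curve_poly i : size (curve_poly i) = N.+2.
Proof.
rewrite /curve_poly; set t := nth _ _ _.
by rewrite size_mulX -?size_poly_eq0 polyseq_curve size_rcons size_tuple.
Qed.

Lemma size_curve_polyB i c : size (curve_poly i - c%:P)%R = N.+2.
Proof.
rewrite size_polyDl ?size_curve_poly // size_polyN.
by rewrite (leq_ltn_trans (size_polyC_leq1 _)).
Qed.

Lemma curve_count_at i b y :
  count (fun x => curve i b x == y) (iota 0 q) <= N.+1.
Proof.
have [yq|yq] := ltnP y q; last first.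
  rewrite (@eq_count _ _ pred0) ?count_pred0 // => x /=.
  by apply/eqP => xy; have := curve_lt i b x; rewrite xy ltnNge yq.
have s := size_curve_polyB i (point y - point b).
apply: leq_trans (@count_roots (curve_poly i - (point y - point b)%:P)%R _ _).
- apply: sub_count => x /= /eqP <-; rewrite /curve coordK.
  by rewrite !hornerE [(point b + _)%R]addrC addrK subrr.
- by rewrite -size_poly_eq0 s.
- by rewrite s.
Qed.

Lemma curve_count_meet i j b b' : i < q ^ N -> j < q ^ N -> i != j ->
  count (fun x => curve i b x == curve j b' x) (iota 0 q) <= N.+1.
Proof.
move=> iq jq ij.
have sE : size (enum {: N.-tuple F}) = q ^ N.
  by rewrite -cardE card_tuple card_grid_field.
set p := (curve_poly i - curve_poly j + (point b - point b')%:P)%R.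
apply: leq_trans (@count_roots p _ _).
- apply: sub_count => x /= /eqP /(can_inj coordK) xE.
  rewrite /p !hornerD !hornerN hornerC; apply/eqP.
  rewrite addrACA [(_.[_] + point b)%R]addrC xE -opprD.
  by rewrite [(_.[_] + point b')%R]addrC subrr.
(* The difference is a nonzero polynomial times ['X], hence of size at least 2, and adding a
   constant cannot cancel it. *)
- rewrite /p /curve_poly -mulrBl.
  set d := (Poly _ - Poly _)%R.
  have d0 : d != 0%R.
    rewrite subr_eq0; apply/negP => /eqP /(congr1 (fun p : {poly F} => p : seq F)).
    rewrite /= !polyseq_curve => /rcons_inj [] /val_inj /eqP.
    by rewrite nth_uniq ?enum_uniq ?sE // (negPf ij).
  have sd : 0 < size d by rewrite size_poly_gt0.
  rewrite -size_poly_eq0 size_polyDl ?size_mulX //.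
  by rewrite (leq_ltn_trans (size_polyC_leq1 _)).
- rewrite (leq_trans (size_polyD _ _)) // geq_max (leq_trans (size_polyD _ _)).
    by rewrite (leq_trans (size_polyC_leq1 _)).
  by rewrite geq_max size_polyN !size_curve_poly leqnn.
Qed.

(** The translates of one curve are disjoint, so a given point of the grid lies on at most one of
    them. *)
Lemma curve_count_shift i x y :
  count (fun b => curve i b x == y) (iota 0 q) <= 1.
Proof.
have [yq|yq] := ltnP y q; last first.
  rewrite (@eq_count _ _ pred0) ?count_pred0 // => b /=.
  by apply/eqP => xy; have := curve_lt i b x; rewrite xy ltnNge yq.
apply: (@count_point_inj
  (fun z => coord (z + (curve_poly i).[point x]) == y)%R).
case=> [|z1 [|z2 rs]] //= /and3P[/eqP y1 /eqP y2 _] /andP[].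
rewrite inE negb_or => /andP[/eqP[]]; apply: (@addIr _ (curve_poly i).[point x]%R).
by apply: (can_inj coordK); rewrite y1 y2.
Qed.

End Curves.

(** * Double counting and pigeonhole *)

Lemma sum_iota_count (J : Type) (bad : nat -> J -> bool) (s : seq J) (m n : nat) :
  \sum_(x <- iota m n) count (bad x) s
  = \sum_(j <- s) count (bad^~ j) (iota m n).
Proof.
under eq_bigr do rewrite -sum1_count big_mkcond /=.
rewrite exchange_big /=; apply: eq_bigr => j _.
by rewrite -sum1_count [RHS]big_mkcond.
Qed.

Lemma sum_seq_leq (J : eqType) (f : J -> nat) (s : seq J) (n : nat) :
  {in s, forall j, f j <= n} -> \sum_(j <- s) f j <= n * size s.
Proof.
elim: s => [|j s IH] fn; first by rewrite big_nil.
rewrite big_cons mulnS leq_add ?fn ?mem_head ?IH // => i si.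
by rewrite fn // inE si orbT.
Qed.

Lemma pigeonhole_seq (J : Type) (f : J -> nat) (s : seq J) (n : nat) :
  \sum_(j <- s) f j < n.+1 * size s -> has (fun j => f j <= n) s.
Proof.
elim: s => [|j s IH]; first by rewrite big_nil muln0.
rewrite big_cons mulnS /=; have [//|nf /=] := leqP (f j) n.
move=> sn; apply: IH; rewrite -(ltn_add2l n.+1).
by rewrite (leq_ltn_trans _ sn) // leq_add2r.
Qed.

(** * Numbers as bit strings *)

Section Codes.

Variable b : nat.

Definition encode (x : nat) : b.-bseq bool :=
  nth [bseq] (enum {: b.-bseq bool}) x.

Definition decode (s : b.-bseq bool) : nat := index s (enum {: b.-bseq bool}).

(** The strings of length exactly [b] already provide [2 ^ b] codes. *)
Lemma encodeK : {in gtn (2 ^ b), cancel encode decode}.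
Proof.
move=> x xb; rewrite /decode index_uniq ?enum_uniq // -cardE.
apply: leq_trans xb _; rewrite -[2]card_bool -card_tuple.
apply: (@leq_card _ _ (fun t : b.-tuple bool => bseq_of_tuple t)) => s t st.
by apply: val_inj; rewrite -[LHS]/(val (bseq_of_tuple s)) st.
Qed.

End Codes.

(** * Algorithms that broadcast according to a fixed list of rounds *)

Section Broadcast.

Variable St : Type.

Record round := Round { msg : St -> nat; upd : St -> seq nat -> St }.

(** The state is paired with the number of elapsed rounds, so that the vertices
   know which round of the fixed list [rs] comes next. *)
Definition broadcast_algorithm (b : nat) (rs : seq round)
    (st0 : nat -> nat -> St) (out : St -> bool) : congest_algorithm b :=
  {| state := nat * St;
     init i d := (0, st0 i d);
     send s _ :=
       if onth rs s.1 is Some a then encode b (msg a s.2) else [bseq];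
     receive s ms :=
       if onth rs s.1 is Some a
       then (s.1.+1, upd a s.2 [seq decode m | m <- ms]) else s;
     output s := if s.1 < size rs then None else Some (out s.2) |}.

Section Execution.

Variables (V : finType) (ports : V -> seq V) (b : nat).

Definition apply_round (s : V -> St) (a : round) : V -> St :=
  fun v => upd a (s v) [seq decode (encode b (msg a (s u))) | u <- ports v].

Definition exec (rs : seq round) (s : V -> St) : V -> St := foldl apply_round s rs.

Lemma exec_cat rs1 rs2 s : exec (rs1 ++ rs2) s = exec rs2 (exec rs1 s).
Proof. exact: foldl_cat. Qed.

Lemma exec_cons a rs s : exec (a :: rs) s = exec rs (apply_round s a).
Proof. by []. Qed.

Lemma exec_loop (I : nat -> (V -> St) -> Prop) (f : nat -> seq round) n s :
  I 0 s -> (forall i s, i < n -> I i s -> I i.+1 (exec (f i) s)) ->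
  I n (exec (flatten [seq f i | i <- iota 0 n]) s).
Proof.
move=> I0 IS; elim: n IS => [|n IH] IS //.
rewrite -[in iota _ _]addn1 iotaD map_cat flatten_cat /= cats0 exec_cat.
by apply: (IS) => //; apply: IH => i t ni; apply: IS; rewrite ltnW.
Qed.

(** Bandwidth enters here: once all messages are below [2 ^ b], the coding disappears from a
    round. *)
Lemma apply_roundE (s : V -> St) a v :
  (forall u, msg a (s u) < 2 ^ b) ->
  apply_round s a v = upd a (s v) [seq msg a (s u) | u <- ports v].
Proof.
by move=> sb; congr upd; apply: eq_map => u; rewrite encodeK //; apply: sb.
Qed.

Lemma run_broadcast rs st0 out (id : V -> nat) t v :
  run (broadcast_algorithm b rs st0 out) ports id t v
  = (minn t (size rs),
     exec (take t rs) (fun v => st0 (id v) (size (ports v))) v).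
Proof.
elim: t v => [|t IH] v; first by rewrite take0 min0n.
rewrite /= IH /=; have [tr|tr] := ltnP t (size rs); last first.
  rewrite (minn_idPr (leqW tr)) onth_default //.
  by rewrite !take_oversize ?(leqW tr).
case ra: (onth rs t) => [a|]; last by have := onthTE rs t; rewrite ra tr.
rewrite (minn_idPl tr) (take_nth a) //.
have -> : nth a rs t = a by exact: onth_nth.
rewrite -cats1 exec_cat /= /apply_round -map_comp.
congr (_, upd _ _ _); apply: eq_map => u /=.
by rewrite IH /= (minn_idPl (ltnW tr)) ra.
Qed.

(** Nothing is output before the last round and the state is frozen after it, so decisions are
    irrevocable. *)
Lemma broadcast_computes rs st0 out (id : V -> nat) :
  let s := exec rs (fun v => st0 (id v) (size (ports v))) in
  computes_in (broadcast_algorithm b rs st0 out) ports id (size rs)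
    [set v | out (s v)].
Proof.
split=> [t v x|v]; rewrite !run_broadcast /=; last first.
  by rewrite minnn ltnn take_size inE.
have [tr|tr] := ltnP t (size rs); first by rewrite tr.
by rewrite (minn_idPr (leqW tr)) !take_oversize ?(leqW tr).
Qed.

End Execution.

End Broadcast.

(** * Loops, vertex states and the rounds of the algorithm *)

Lemma size_loop (T : Type) (f : nat -> seq T) (k n : nat) :
  (forall i, size (f i) = k) ->
  size (flatten [seq f i | i <- iota 0 n]) = n * k.
Proof.
move=> fk; rewrite -{2}(size_iota 0 n); elim: (iota 0 n) => //= i s IH.
by rewrite size_cat fk IH mulSn.
Qed.

Record vertex_state := VertexState {
  color : nat;
  nbr_colors : seq nat;
  class : option nat;
  outs : seq bool;
  nbr_finals : seq nat;
  shift : nat;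
  final : option nat;
  alive : bool }.

Definition start (id : nat) : vertex_state :=
  VertexState id [::] None [::] [::] 0 None true.

Definition set_color i s :=
  VertexState i (nbr_colors s) (class s) (outs s) (nbr_finals s) (shift s)
    (final s) (alive s).

Definition set_nbr_colors ms s :=
  VertexState (color s) ms (class s) (outs s) (nbr_finals s) (shift s)
    (final s) (alive s).

Definition set_class c os s :=
  VertexState (color s) (nbr_colors s) (Some c) os (nbr_finals s) (shift s)
    (final s) (alive s).

Definition set_shift ms b s :=
  VertexState (color s) (nbr_colors s) (class s) (outs s) ms b
    (final s) (alive s).

Definition set_final f s :=
  VertexState (color s) (nbr_colors s) (class s) (outs s) (nbr_finals s)
    (shift s) (Some f) (alive s).

Definition set_dead s :=
  VertexState (color s) (nbr_colors s) (class s) (outs s) (nbr_finals s)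
    (shift s) (final s) false.

Definition option_code (o : option nat) : nat := if o is Some c then c.+1 else 0.

Definition first_below (n : nat) (a : pred nat) : nat := find a (iota 0 n).

Lemma first_belowP n a :
  has a (iota 0 n) -> first_below n a < n /\ a (first_below n a).
Proof.
move=> an; have := an; rewrite has_find size_iota => lt_n; split=> //.
by have := nth_find 0 an; rewrite nth_iota.
Qed.

Lemma eq_first_below n a a' :
  a =1 a' -> first_below n a = first_below n a'.
Proof. by move=> aa'; apply: eq_find. Qed.

(** The new color codes a point of the own curve that lies on no curve of a neighbour. *)
Definition linial_round (k N : nat) : round vertex_state := {|
  msg := color;
  upd s ms :=
    let x := first_below (2 ^ k) (fun x =>
      all (fun j => curve k N j 0 x != curve k N (color s) 0 x) ms) in
    set_color (x * 2 ^ k + curve k N (color s) 0 x) s |}.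

Definition learn_round : round vertex_state :=
  {| msg := color; upd s ms := set_nbr_colors ms s |}.

(** A port conflicts if the neighbour is already in class [y], or is undecided and tries [y] in the
    same round. The conflicting ports become the out-neighbours. *)
Definition class_round (k N beta x : nat) : round vertex_state := {|
  msg s := option_code (class s);
  upd s ms :=
    if class s is Some _ then s else
    let y := curve k N (color s) 0 x in
    let os := [seq (if p.1 is c.+1 then c else curve k N p.2 0 x) == y
                | p <- zip ms (nbr_colors s)] in
    if count id os <= beta then set_class y os s else s |}.

Definition on_curve (k N i b m : nat) : bool :=
  if m is f.+1 then curve k N i b (f %/ 2 ^ k) == f %% 2 ^ k else false.

Definition shift_round (k N Delta : nat) : round vertex_state := {|
  msg s := option_code (final s);
  upd s ms :=
    set_shift ms (first_below (2 ^ k) (fun b =>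
      count (on_curve k N (color s) b) ms <= Delta %/ 2 ^ k)) s |}.

(** The messages are the shifts just chosen, which together with the known colors determine the
    translated curves of the neighbours. *)
Definition final_round (k N c : nat) : round vertex_state := {|
  msg := shift;
  upd s ms :=
    if class s == Some c then
      let y x := curve k N (color s) (shift s) x in
      let x := first_below (2 ^ k) (fun x =>
        ((x * 2 ^ k + y x).+1 \notin nbr_finals s) &&
        all (fun p => p.1.1 ==> (curve k N p.1.2 p.2 x != y x))
          (zip (zip (outs s) (nbr_colors s)) ms)) in
      set_final (x * 2 ^ k + y x) s
    else s |}.

Definition digit (B l : nat) (s : vertex_state) : nat :=
  (odflt 0 (final s) %/ B ^ l) %% B.

(** Run for increasing [d], this is a greedy choice by the digit [l]. The message is a boolean read
    as 0 or 1. *)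
Definition sift_round (B l d : nat) : round vertex_state := {|
  msg s := alive s && (digit B l s < d);
  upd s ms :=
    if [&& alive s, digit B l s == d & 1 \in ms] then set_dead s else s |}.

(** * Correctness of the phases, beginning with Linial's color reduction *)

Section Phases.

Variables (V : finType) (e : rel V) (ports : V -> seq V) (b Delta : nat).
Hypothesis e_sym : symmetric e.
Hypothesis portsP : port_numbering e ports.
Hypothesis ports_size : forall v, size (ports v) <= Delta.

Implicit Types (s : V -> vertex_state) (u v : V) (k N : nat).

Lemma mem_ports u v : (u \in ports v) = e v u.
Proof. by have [_] := portsP v; apply. Qed.

Definition proper_coloring (n : nat) s : Prop :=
  (forall u v, e u v -> color (s u) != color (s v)) /\
  (forall v, color (s v) < n).

Definition untouched s : Prop :=
  forall v, [/\ class (s v) = None, final (s v) = None & alive (s v)].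

Lemma pair_code_lt q x y : x < q -> y < q -> x * q + y < q * q.
Proof. by move=> xq yq; rewrite -addn1 -addnA addn1; nia. Qed.

Lemma pair_code_inj q x y x' y' : y < q -> y' < q ->
  x * q + y = x' * q + y' -> x = x' /\ y = y'.
Proof.
move=> yq yq' xy; have q0 : 0 < q by apply: leq_ltn_trans yq.
have: (x * q + y) %/ q = (x' * q + y') %/ q by rewrite xy.
have: (x * q + y) %% q = (x' * q + y') %% q by rewrite xy.
by rewrite !modnMDl !divnMDl // !modn_small // !divn_small // !addn0.
Qed.

(** [N] plays two roles: colors have [N] bits, and they index [N]-tuples of field elements. Each
    neighbour spoils at most [N.+1] of the [2 ^ k] points of the curve, so a good point is left. *)
Lemma linial_step k N s :
  0 < k -> N <= b -> N.+1 * Delta < 2 ^ k ->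
  proper_coloring (2 ^ N) s -> untouched s ->
  let s' := apply_round ports b s (linial_round k N) in
  proper_coloring (2 ^ (2 * k)) s' /\ untouched s'.
Proof.
move=> k0 Nb Nk [s_prop s_lt] s_un /=.
have lt_b u : color (s u) < 2 ^ b by rewrite (leq_trans (s_lt u)) ?leq_exp2l.
have Nq u : color (s u) < (2 ^ k) ^ N.
  by rewrite -expnM (leq_trans (s_lt u)) // leq_exp2l //; nia.
split; last by move=> v; rewrite apply_roundE //; have [] := s_un v.
pose x v := first_below (2 ^ k) (fun x => all (fun j =>
  curve k N j 0 x != curve k N (color (s v)) 0 x) [seq color (s u) | u <- ports v]).
have xP v : x v < 2 ^ k /\ all (fun j => curve k N j 0 (x v)
    != curve k N (color (s v)) 0 (x v)) [seq color (s u) | u <- ports v].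
  apply: first_belowP.
  have := @pigeonhole_seq _ (fun x => count (fun j => curve k N j 0 x
    == curve k N (color (s v)) 0 x) [seq color (s u) | u <- ports v])
    (iota 0 (2 ^ k)) 0.
  rewrite size_iota mul1n sum_iota_count => /(_ _)/hasP[].
    apply: leq_ltn_trans (sum_seq_leq (n := N.+1) _) _.
      move=> _ /mapP[u uv ->]; apply: curve_count_meet => //.
      by rewrite eq_sym s_prop // -mem_ports.
    by rewrite size_map (leq_ltn_trans _ Nk) // leq_mul2l ports_size orbT.
  move=> y yq; rewrite leqn0 -[_ == 0]negbK -lt0n -has_count => yN.
  by apply/hasP; exists y => //; rewrite all_predC.
have sE v : color (apply_round ports b s (linial_round k N) v)
    = x v * 2 ^ k + curve k N (color (s v)) 0 (x v).
  by rewrite apply_roundE.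
split=> [u v uv|v]; rewrite !sE; last first.
  by rewrite mul2n -addnn expnD pair_code_lt ?curve_lt //; have [] := xP v.
apply/eqP => /pair_code_inj[]; rewrite ?curve_lt // => xuv.
(* The point chosen by [u] avoids the whole curve of [v], which contains the point chosen by [v]. *)
have [_ /allP/(_ (color (s v)))] := xP u.
rewrite map_f ?mem_ports // xuv => /(_ isT)/eqP + H.
by rewrite H.
Qed.

Lemma linial_phase (ks Ns : nat -> nat) T s :
  (forall i, i < T -> [/\ 0 < ks i, Ns i <= b, (Ns i).+1 * Delta < 2 ^ ks i
    & Ns i.+1 = 2 * ks i]) ->
  proper_coloring (2 ^ Ns 0) s -> untouched s ->
  let s' := exec ports b
    (flatten [seq [:: linial_round (ks i) (Ns i)] | i <- iota 0 T]) s in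
  proper_coloring (2 ^ Ns T) s' /\ untouched s'.
Proof.
move=> ksP s_prop s_un.
pose I i (t : V -> vertex_state) := proper_coloring (2 ^ Ns i) t /\ untouched t.
apply: (@exec_loop _ _ _ _ I) => // i t /ksP[k0 Nb Nk N1] [tp tu].
by rewrite /I N1; apply: linial_step.
Qed.

(** * Choice of classes with few conflicts *)

Definition informed n s : Prop :=
  proper_coloring n s /\
  forall v, [/\ nbr_colors (s v) = [seq color (s u) | u <- ports v],
                final (s v) = None & alive (s v)].

Lemma learn_phase n s : n <= 2 ^ b -> proper_coloring n s -> untouched s ->
  let s' := apply_round ports b s learn_round in
  informed n s' /\ forall v, class (s' v) = None.
Proof.
move=> nb [s_prop s_lt] s_un s'.
have s_b u : color (s u) < 2 ^ b by rewrite (leq_trans (s_lt u)).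
have E v := @apply_roundE _ _ ports b s learn_round v s_b; rewrite -/s' in E.
split=> [|v]; last by rewrite E; have [] := s_un v.
split=> [|v]; first by split=> [u v uv|v]; rewrite !E ?s_prop ?s_lt.
by rewrite E; have [_ -> ->] := s_un v.
Qed.

Definition out_arc s v u : bool := nth false (outs (s v)) (index u (ports v)).

(** Every vertex keeps at most [beta] out-neighbours in its class: these are the
   conflicting neighbours at the time at which the class is chosen. *)
Definition partial_classes Q beta s : Prop :=
  (forall v c, class (s v) = Some c ->
     [/\ c < Q, outs (s v) = [seq out_arc s v u | u <- ports v]
       & count (out_arc s v) (ports v) <= beta]) /\
  (forall u v c, e u v -> class (s u) = Some c -> class (s v) = Some c ->
     out_arc s u v || out_arc s v u).

Definition conflict k N s x v u : bool :=
  (if class (s u) is Some c then c else curve k N (color (s u)) 0 x)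
    == curve k N (color (s v)) 0 x.

Lemma nth_map_index (T : eqType) (g : T -> bool) (l : seq T) x :
  x \in l -> nth false [seq g y | y <- l] (index x l) = g x.
Proof. by move=> xl; rewrite (nth_map x) ?index_mem // nth_index. Qed.

Lemma class_roundE k N beta x n s :
  2 ^ k < 2 ^ b -> informed n s -> partial_classes (2 ^ k) beta s ->
  forall v, apply_round ports b s (class_round k N beta x) v =
    if class (s v) is Some _ then s v else
    if count (conflict k N s x v) (ports v) <= beta
    then set_class (curve k N (color (s v)) 0 x)
           [seq conflict k N s x v u | u <- ports v] (s v)
    else s v.
Proof.
move=> kb [_ s_nbr] [s_cls _] v; rewrite apply_roundE => [|u]; last first.
  rewrite /= /option_code; case cu: (class _) => [c|]; last by rewrite expn_gt0.
  by apply: leq_ltn_trans kb; have [] := s_cls _ _ cu.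
rewrite /=; case: (class (s v)) => //; have [-> _ _] := s_nbr v.
have -> : [seq (if p.1 is c.+1 then c else curve k N p.2 0 x)
       == curve k N (color (s v)) 0 x
    | p <- zip [seq option_code (class (s u)) | u <- ports v]
               [seq color (s u) | u <- ports v]]
    = [seq conflict k N s x v u | u <- ports v].
  rewrite zip_map -map_comp; apply: eq_map => u /=.
  by rewrite /conflict; case: (class (s u)).
by rewrite count_map.
Qed.

(** This bounds the number of conflicts that [v] has had with [u] in the first [i] rounds: the first
    term covers the rounds with [u] undecided, the second those after its choice. Both count over
    all past points, so each stays at most [N.+1]. *)
Definition conflict_weight k N s i v u : nat :=
  count (fun x => curve k N (color (s u)) 0 x == curve k N (color (s v)) 0 x)
    (iota 0 i) +
  (if class (s u) is Some c
   then count (fun x => curve k N (color (s v)) 0 x == c) (iota 0 i) else 0).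

(** A vertex that stays undecided has just seen more than [beta] conflicts, which its total weight
    records. *)
Lemma class_step k N beta n s i :
  2 ^ k < 2 ^ b -> i < 2 ^ k ->
  0 < k -> informed n s -> partial_classes (2 ^ k) beta s ->
  (forall v, class (s v) = None ->
    beta.+1 * i <= \sum_(u <- ports v) conflict_weight k N s i v u) ->
  let s' := apply_round ports b s (class_round k N beta i) in
  [/\ informed n s', partial_classes (2 ^ k) beta s' &
  forall v, class (s' v) = None ->
    beta.+1 * i.+1 <= \sum_(u <- ports v) conflict_weight k N s' i.+1 v u].
Proof.
move=> kb ik k0 s_inf s_part s_w s'.
have E := class_roundE N i kb s_inf s_part; rewrite -/s' in E.
have [[s_prop s_lt] s_nbr] := s_inf; have [s_cls s_out] := s_part.
have cE v : color (s' v) = color (s v).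
  by rewrite E; case: (class _) => //; case: ifP.
have nE v : [/\ nbr_colors (s' v) = nbr_colors (s v),
    final (s' v) = final (s v) & alive (s' v) = alive (s v)].
  by rewrite E; case: (class _) => //; case: ifP.
have oldE v c : class (s v) = Some c -> s' v = s v by rewrite E => ->.
have newP v c : class (s v) = None -> class (s' v) = Some c ->
    [/\ c = curve k N (color (s v)) 0 i,
        outs (s' v) = [seq conflict k N s i v u | u <- ports v]
      & count (conflict k N s i v) (ports v) <= beta].
  by rewrite E => sv; rewrite sv; case: ifP => [? [<-]|]; rewrite ?sv.
have new_arc v c u : class (s v) = None -> class (s' v) = Some c -> e v u ->
    out_arc s' v u = conflict k N s i v u.
  move=> v0 vc vu; have [_ oE _] := newP _ _ v0 vc.
  by rewrite /out_arc oE nth_map_index ?mem_ports.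
have old_arc v c u : class (s v) = Some c -> out_arc s' v u = out_arc s v u.
  by move=> vc; rewrite /out_arc (oldE _ _ vc).
split.
- split; first by split=> [u v uv|v]; rewrite !cE ?s_prop ?s_lt.
  move=> v; have [-> -> ->] := nE v; have [-> -> ->] := s_nbr v.
  by split=> //; apply: eq_map => u; rewrite cE.
- split=> [v c vc|u v c uv uc vc].
    case v0: (class (s v)) => [c'|].
      move: vc; rewrite (oldE _ _ v0) => /s_cls[cq oE o_beta].
      rewrite {1}oE (eq_count (fun u => old_arc _ _ u v0)).
      by split=> //; apply: eq_map => u; rewrite (old_arc _ _ _ v0).
    have [cE' oE o_beta] := newP _ _ v0 vc.
    have arcE : {in ports v, out_arc s' v =1 conflict k N s i v}.
      by move=> u; rewrite mem_ports => /(new_arc _ _ _ v0 vc).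
    split; first by rewrite cE' curve_lt.
      by rewrite oE; apply/eq_in_map => u /arcE ->.
    by rewrite (eq_in_count arcE).
  (* If both classes are old, the old arc is kept. Otherwise, by symmetry, [v] chooses in this round
     and sees the conflict with [u]. *)
  wlog v0 : u v uv uc vc / class (s v) = None => [wl|].
    case v0: (class (s v)) => [c1|]; last exact: wl.
    case u0: (class (s u)) => [c2|]; last first.
      by rewrite orbC; apply: wl => //; rewrite e_sym.
    rewrite (old_arc _ _ _ v0) (old_arc _ _ _ u0).
    move: uc vc; rewrite (oldE _ _ u0) (oldE _ _ v0); exact: s_out.
  rewrite (new_arc _ _ _ v0 vc) 1?e_sym //; apply/orP; right.
  have [cv _ _] := newP _ _ v0 vc; rewrite /conflict.
  case u0: (class (s u)) => [c'|].
    by move: uc; rewrite (oldE _ _ u0) u0 => -[->]; rewrite cv.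
  by have [<- _ _] := newP _ _ u0 uc; rewrite cv.
move=> v v1.
have v0 : class (s v) = None.
  by case v0: (class (s v)) => [c|] //; rewrite (oldE _ _ v0) v0 in v1.
have many : beta < count (conflict k N s i v) (ports v).
  rewrite ltnNge; apply/negP => few.
  by move: v1; rewrite E v0 few.
rewrite mulnS (leq_trans (leq_add many (s_w v v0))) //.
(* Neighbour by neighbour, a conflict at the point [i] adds 1 to one of the two terms of the
   weight. *)
rewrite -sum1_count big_mkcond -big_split /=; apply: leq_sum => u _.
have iotaS : iota 0 i.+1 = iota 0 i ++ [:: i] by rewrite -[i.+1]addn1 iotaD.
rewrite /conflict_weight !cE /conflict iotaS !count_cat /= !addn0.
case u0: (class (s u)) => [c|].
  rewrite (oldE _ _ u0) u0 [c == _]eq_sym count_cat /= addn0.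
  by case: (_ == c); case: (_ == curve _ _ _ _ _); lia.
by case: (class (s' u)) => [c|]; case: (curve k N (color (s u)) 0 i == _); lia.
Qed.

Definition arbdefective n Q beta s : Prop :=
  [/\ informed n s, partial_classes Q beta s & forall v, class (s v) <> None].

(** A vertex undecided after all [2 ^ k] points would have weight at least [beta.+1 * 2 ^ k], while
    each of its at most [Delta] neighbours contributes at most [2 * N.+1]. *)
Lemma class_phase k N beta n s :
  2 ^ k < 2 ^ b -> 0 < k ->
  2 * N.+1 * Delta < beta.+1 * 2 ^ k -> n <= (2 ^ k) ^ N ->
  informed n s -> (forall v, class (s v) = None) ->
  arbdefective n (2 ^ k) beta
    (exec ports b (flatten [seq [:: class_round k N beta x]
                             | x <- iota 0 (2 ^ k)]) s).
Proof.
move=> kb k0 Nk nk s_inf s_none.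
pose I i (t : V -> vertex_state) :=
  [/\ informed n t, partial_classes (2 ^ k) beta t &
  forall v, class (t v) = None ->
    beta.+1 * i <= \sum_(u <- ports v) conflict_weight k N t i v u].
have: I (2 ^ k) (exec ports b (flatten [seq [:: class_round k N beta x]
                             | x <- iota 0 (2 ^ k)]) s).
  apply: exec_loop => [|i t ik [t_inf t_part t_w]]; last exact: class_step.
  split=> // [|v _]; last by rewrite muln0.
  by split=> [v c|u v c uv]; rewrite s_none.
move: (exec _ _ _ _) => t [t_inf t_part t_w]; split=> // v v0.
have := t_w v v0; rewrite leqNgt => /negP; apply.
apply: leq_ltn_trans Nk; have [[t_prop t_lt] _] := t_inf.
apply: leq_trans (sum_seq_leq (n := 2 * N.+1) _) _; last first.
  by rewrite leq_mul2l ports_size orbT.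
move=> u uv; rewrite mul2n -addnn leq_add //.
  rewrite curve_count_meet ?(leq_trans (t_lt _) nk) //.
  by rewrite eq_sym t_prop // -mem_ports.
by case: (class (t u)) => // c; apply: curve_count_at.
Qed.

(** * Final colors, assigned class by class *)

Definition classified n Q beta s : Prop :=
  [/\ proper_coloring n s,
      forall v, nbr_colors (s v) = [seq color (s u) | u <- ports v],
      partial_classes Q beta s
    & forall v, class (s v) <> None].

Lemma classified_ext n Q beta s s' :
  (forall v, [/\ color (s' v) = color (s v), nbr_colors (s' v) = nbr_colors (s v),
                 class (s' v) = class (s v) & outs (s' v) = outs (s v)]) ->
  classified n Q beta s -> classified n Q beta s'.
Proof.
move=> ss' [[s_prop s_lt] s_nbr [s_cls s_out] s_some].
have cE v : color (s' v) = color (s v) by have [] := ss' v.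
have clE v : class (s' v) = class (s v) by have [] := ss' v.
have aE v u : out_arc s' v u = out_arc s v u.
  by rewrite /out_arc; have [_ _ _ ->] := ss' v.
split.
- by split=> [u v uv|v]; rewrite !cE ?s_prop.
- move=> v; have [_ -> _ _] := ss' v; rewrite s_nbr.
  by apply: eq_map => u; rewrite cE.
- split=> [v c|u v c uv]; rewrite !clE; last by rewrite !aE; apply: s_out.
  move=> /s_cls[cQ oE o_beta]; rewrite (eq_count (aE v)); split=> //.
  by have [_ _ _ ->] := ss' v; rewrite [LHS]oE; apply: eq_map => u; rewrite aE.
- by move=> v; rewrite clE.
Qed.

Definition class_number (x : vertex_state) : nat := odflt 0 (class x).

Definition finalized q c s : Prop :=
  [/\ forall v, alive (s v),
      forall v, isSome (final (s v)) = (class_number (s v) < c),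
      forall v f, final (s v) = Some f -> f < q * q
    & forall u v f, e u v -> final (s u) = Some f -> final (s v) <> Some f].

Lemma on_curve_count_shift k N i m :
  0 < k -> count (fun d => on_curve k N i d m) (iota 0 (2 ^ k)) <= 1.
Proof.
case: m => [|f] k0 /=; first by rewrite count_pred0.
exact: curve_count_shift.
Qed.

(** A taken point blocks only its own abscissa, and only if it lies on the curve. *)
Lemma on_curve_count_point k N i d m :
  0 < k ->
  count (fun x => m == (x * 2 ^ k + curve k N i d x).+1) (iota 0 (2 ^ k))
    <= on_curve k N i d m.
Proof.
move=> k0; have q0 : 0 < 2 ^ k by rewrite expn_gt0.
case: m => [|f] /=; first by rewrite count_pred0.
set hit := curve k N i d (f %/ 2 ^ k) == f %% 2 ^ k.
apply: (@leq_trans (count (fun x => (x == f %/ 2 ^ k) && hit) (iota 0 (2 ^ k)))).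
  apply: sub_count => x /eqP[] fE /=; have cq := curve_lt N k0 i d x.
  by rewrite /hit fE divnMDl // modnMDl divn_small // modn_small // addn0 !eqxx.
case: hit; last by under eq_count do rewrite andbF; rewrite count_pred0.
under eq_count do rewrite andbT.
by rewrite (count_uniq_mem _ (iota_uniq _ _)) leq_b1.
Qed.

(** On the chosen translate, taken points block at most [Delta %/ 2 ^ k] abscissas, and the at most
    [beta] out-neighbours block at most [N.+1] each; the sum is below [2 ^ k]. *)
Lemma final_step k N n Q beta c s :
  2 * k < b -> 0 < k -> n <= (2 ^ k) ^ N ->
  Delta %/ 2 ^ k + N.+1 * beta < 2 ^ k ->
  classified n Q beta s -> finalized (2 ^ k) c s ->
  let s' := exec ports b [:: shift_round k N Delta; final_round k N c] s in
  classified n Q beta s' /\ finalized (2 ^ k) c.+1 s'.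
Proof.
move=> kb k0 nq small s_cls [s_alive s_done s_lt s_prop].
rewrite /exec /=; set s1 := apply_round ports b s _; set s' := apply_round _ _ _ _.
have q_b : 2 ^ k * 2 ^ k < 2 ^ b by rewrite -expnD addnn -mul2n ltn_exp2l.
have q0 : 0 < 2 ^ k by rewrite expn_gt0.
pose ms v := [seq option_code (final (s u)) | u <- ports v].
pose sh v := first_below (2 ^ k) (fun d =>
  count (on_curve k N (color (s v)) d) (ms v) <= Delta %/ 2 ^ k).
have E1 v : s1 v = set_shift (ms v) (sh v) (s v).
  rewrite /s1 apply_roundE // => u /=.
  case fu: (final (s u)) => [f|]; last by rewrite expn_gt0.
  by rewrite (leq_ltn_trans _ q_b) //; apply: s_lt fu.
clearbody s1.
have shP v : sh v < 2 ^ k /\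
    count (on_curve k N (color (s v)) (sh v)) (ms v) <= Delta %/ 2 ^ k.
  apply: (@first_belowP (2 ^ k) (fun d =>
    count (on_curve k N (color (s v)) d) (ms v) <= Delta %/ 2 ^ k)).
  (* Averaging over the [2 ^ k] translates: each of the at most [Delta] taken points lies on at most
     one. *)
  apply: pigeonhole_seq; rewrite sum_iota_count size_iota.
  apply: leq_ltn_trans (sum_seq_leq (n := 1) _) _.
    by move=> m _; apply: on_curve_count_shift.
  by rewrite mul1n size_map (leq_ltn_trans (ports_size v)) // ltn_ceil.
have s1_cls : classified n Q beta s1.
  by apply: classified_ext s_cls => v; rewrite E1.
have [[s_col s_col_lt] s_nbr [s_class s_out] s_some] := s_cls.
pose y v x := curve k N (color (s v)) (sh v) x.
pose good v x := ((x * 2 ^ k + y v x).+1 \notin ms v) &&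
  all (fun u => out_arc s v u ==> (y u x != y v x)) (ports v).
pose x v := first_below (2 ^ k) (good v).
have E v : s' v = if class (s v) == Some c
    then set_final (x v * 2 ^ k + y v (x v)) (s1 v) else s1 v.
  rewrite /s' apply_roundE => [|u]; last first.
    rewrite E1 /=; have [shq _] := shP u.
    by rewrite (ltn_trans shq) // (leq_trans _ q_b) // ltnS leq_pmulr.
  rewrite /= E1 /=; case: eqP => // vc.
  have [_ outE _] := s_class _ _ vc.
  rewrite outE s_nbr zip_map.
  have -> : [seq shift (s1 u) | u <- ports v] = [seq sh u | u <- ports v].
    by apply: eq_map => u; rewrite E1.
  rewrite zip_map (@eq_first_below _ _ (good v)) // => z.
  by rewrite /good all_map.
have goodP v : class (s v) = Some c -> x v < 2 ^ k /\ good v (x v).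
  move=> vc; have [_ _ few] := s_class _ _ vc.
  apply: first_belowP.
  pose clash z u := out_arc s v u && (y u z == y v z).
  (* The function counts the obstructions at [z]; an abscissa with none exists if their total is
     below [2 ^ k]. *)
  have := @pigeonhole_seq _ (fun z => count (pred1 (z * 2 ^ k + y v z).+1) (ms v)
    + count (clash z) (ports v)) (iota 0 (2 ^ k)) 0.
  rewrite size_iota mul1n big_split /= !sum_iota_count => /(_ _)/hasP[].
    apply: leq_ltn_trans small; apply: leq_add.
      have [_] := shP v; apply: leq_trans.
      rewrite -sum1_count [X in _ <= X]big_mkcond /=; apply: leq_sum => m _.
      apply: leq_trans (on_curve_count_point _ _ _ _ k0) _.
      by case: (on_curve _ _ _ _ _).
    apply: leq_trans (leq_mul (leqnn _) few).
    rewrite -sum1_count big_distrr /= big_mkcond [X in _ <= X]big_mkcond /=.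
    rewrite !big_seq; apply: leq_sum => u; rewrite mem_ports => vu.
    rewrite /clash; case: (out_arc s v u) => /=; last by rewrite count_pred0.
    rewrite muln1; apply: curve_count_meet => //; rewrite ?(leq_trans _ nq) //.
    by rewrite eq_sym s_col.
  move=> z zq; rewrite leqn0 addn_eq0 => /andP[z1 z2].
  apply/hasP; exists z => //; rewrite /good -has_pred1 has_count -eqn0Ngt z1.
  apply/allP => u uv; apply/implyP => vu; apply/negP => yz.
  by move: z2; rewrite -[_ == 0]negbK -lt0n -has_count => /hasP[]; exists u => //;
    rewrite /clash vu.
have clE v : class (s' v) = class (s v) by rewrite E E1; case: ifP.
have aE v : alive (s' v) = alive (s v) by rewrite E E1; case: ifP.
have fE v : final (s' v) = if class (s v) == Some c
    then Some (x v * 2 ^ k + y v (x v)) else final (s v).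
  by rewrite E E1; case: ifP.
have s_pend v : class (s v) = Some c -> final (s v) = None.
  move=> vc; have := s_done v; rewrite /class_number vc ltnn.
  by case: (final (s v)).
split; first by apply: classified_ext s1_cls => v; rewrite E; case: ifP.
split=> [v|v|v f|u v f uv].
- by rewrite aE.
- rewrite fE /class_number clE ltnS leq_eqVlt; have := s_some v.
  case vc: (class (s v)) => [c'|] // _.
  have -> : (Some c' == Some c) = (c' == c) by [].
  by case: eqP => //= _; rewrite s_done /class_number vc.
- rewrite fE; case: eqP => [vc [<-]|_]; last exact: s_lt.
  by rewrite pair_code_lt ?curve_lt //; have [] := goodP v vc.
have hit w w' g : e w w' -> class (s w) = Some c ->
    final (s w') = Some g -> x w * 2 ^ k + y w (x w) <> g.
  move=> ww' wc w'g wg; have [_ /andP[/negP + _]] := goodP w wc; apply.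
  by apply/mapP; exists w'; rewrite ?mem_ports // w'g wg.
rewrite !fE; case: eqP => [uc|_]; case: eqP => [vc|_]; last exact: s_prop.
(* Both ends choose now. One is an out-neighbour of the other, which has therefore avoided its whole
   curve. *)
- move=> [<-] [] /pair_code_inj[]; rewrite ?curve_lt // => xuv yuv.
  have [_ /andP[_ /allP uP]] := goodP u uc.
  have [_ /andP[_ /allP vP]] := goodP v vc.
  case/orP: (s_out u v c uv uc vc) => a.
    by have := uP v; rewrite mem_ports a /= -yuv -xuv eqxx => /(_ uv).
  by have := vP u; rewrite mem_ports a /= e_sym yuv xuv eqxx => /(_ uv).
- by move=> [<-] /hit H; apply: (H u) => //.
- by move=> ug [vg]; apply: (hit v u f) => //; rewrite e_sym.
Qed.

Lemma final_phase k N n Q beta s :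
  2 * k < b -> 0 < k -> n <= (2 ^ k) ^ N ->
  Delta %/ 2 ^ k + N.+1 * beta < 2 ^ k ->
  arbdefective n Q beta s ->
  let s' := exec ports b (flatten [seq
    [:: shift_round k N Delta; final_round k N c] | c <- iota 0 Q]) s in
  classified n Q beta s' /\ finalized (2 ^ k) Q s'.
Proof.
move=> kb k0 nq small [[s_prop s_inf] s_part s_some].
pose I c (t : V -> vertex_state) := classified n Q beta t /\ finalized (2 ^ k) c t.
apply: (@exec_loop _ _ _ _ I) => [|c t _ [t_cls t_fin]]; last first.
  exact: final_step.
split; first by split=> // v; have [] := s_inf v.
by split=> [v|v|v f|u v f uv]; have [_ fv av] := s_inf v; rewrite ?fv //.
Qed.

(** * Sifting the vertices by the digits of their final colors *)

Section Sift.

Variables (B : nat) (f : V -> nat).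
Hypotheses (b_gt0 : 0 < b) (B_gt0 : 0 < B).

Let dig j v := (f v %/ B ^ j) %% B.

Definition keeps_final s : Prop := forall v, odflt 0 (final (s v)) = f v.

Lemma sift_roundE l d s v : keeps_final s ->
  apply_round ports b s (sift_round B l d) v =
  if [&& alive (s v), dig l v == d
       & has (fun u => alive (s u) && (dig l u < d)) (ports v)]
  then set_dead (s v) else s v.
Proof.
move=> sf; rewrite apply_roundE => [|u /=]; last first.
  by rewrite (leq_ltn_trans (leq_b1 _)) // -[1]/(2 ^ 0) ltn_exp2l.
rewrite /= /digit sf; congr (if [&& _, _ & _] then _ else _).
apply/mapP/hasP => -[u uv]; [move=> uE | move=> uE]; exists u => //.
  by move: uE; rewrite sf /dig; case: (_ && _).
by rewrite sf -/(dig l u) uE.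
Qed.

(** The digit values below [d] have been processed. At [d = B] the last clause, read in both
    directions, gives adjacent survivors the same digit. *)
Definition sifted s0 l d s : Prop :=
  [/\ keeps_final s,
      forall v, alive (s v) -> alive (s0 v),
      forall v, alive (s0 v) -> ~~ alive (s v) ->
        dig l v < d /\ exists u, [/\ e u v, alive (s u) & dig l u < d]
    & forall u v, e u v -> alive (s u) -> alive (s v) -> dig l v < d ->
        dig l v <= dig l u].

Lemma sift_phase l s : keeps_final s ->
  sifted s l B
    (exec ports b (flatten [seq [:: sift_round B l d] | d <- iota 0 B]) s).
Proof.
move=> sf; apply: exec_loop => [|d t _ [tf t_sub t_dom t_eq]].
  by split=> // v ->.
rewrite /exec /=; set t' := apply_round _ _ _ _.
have E v := sift_roundE l d v tf; rewrite -/t' in E.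
have aE v : alive (t' v) = alive (t v) && ~~ ((dig l v == d)
    && has (fun u => alive (t u) && (dig l u < d)) (ports v)).
  rewrite E; case tv: (alive (t v)) => /=; last by rewrite tv.
  by case: ifP => //=; rewrite tv.
(* Vertices with a digit below [d] are safe from now on, so a neighbour that has eliminated a vertex
   survives the loop. *)
have keep v : alive (t v) -> dig l v < d -> alive (t' v).
  by rewrite aE => -> vd; rewrite (ltn_eqF vd).
split=> [v|v|v v0|u v uv].
- by rewrite E; case: ifP => _; apply: tf.
- by rewrite aE => /andP[/t_sub].
- rewrite aE; case tv: (alive (t v)) => /=; last first.
    move/negbT: tv => /(t_dom _ v0)[vd [u [uv ut ud]]] _.
    by split; [lia | exists u; split; [|exact: keep|lia]].
  rewrite negbK => /andP[/eqP -> /hasP[u uv /andP[ut ud]]].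
  split; first by [].
  by exists u; split; [rewrite e_sym -mem_ports | exact: keep | lia].
- rewrite !aE => /andP[ut _] /andP[vt vP]; rewrite ltnS leq_eqVlt.
  case/orP=> [/eqP vd|vd]; last exact: t_eq.
  move: vP; rewrite vd eqxx /= => /hasPn/(_ u).
  by rewrite mem_ports e_sym ut uv -leqNgt => /(_ isT).
Qed.

Definition sift_rounds (r : nat) : seq (round vertex_state) :=
  flatten [seq flatten [seq [:: sift_round B l d] | d <- iota 0 B]
          | l <- iota 0 r].

Lemma eq_digits x y n : x < B ^ n -> y < B ^ n ->
  (forall j, j < n -> (x %/ B ^ j) %% B = (y %/ B ^ j) %% B) -> x = y.
Proof.
elim: n x y => [|n IH] x y xB yB xy; first by move: xB yB; rewrite expn0; lia.
rewrite (divn_eq x B) (divn_eq y B); congr (_ * _ + _); last first.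
  by have := xy 0 isT; rewrite expn0 !divn1.
apply: IH; rewrite ?ltn_divLR -?expnSr // => j jn.
by rewrite -!divnMA -expnS; apply: xy.
Qed.

(** After [l] digits, adjacent survivors agree on these digits and every vertex is within [l] hops
    of a survivor. Adjacent survivors of all [r] digits would have equal final colors. *)
Lemma sift_ruling_set r s :
  keeps_final s -> (forall v, alive (s v)) ->
  (forall v, f v < B ^ r) -> (forall u v, e u v -> f u <> f v) ->
  ruling_set2 e r [set v | alive (exec ports b (sift_rounds r) s v)].
Proof.
move=> sf s_alive f_lt f_prop.
pose I l (t : V -> vertex_state) := [/\ keeps_final t,
  forall u v j, e u v -> alive (t u) -> alive (t v) -> j < l ->
    dig j u = dig j v
  & forall v, exists2 w, alive (t w) & within_hops e l w v].
have: I r (exec ports b (sift_rounds r) s).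
  apply: exec_loop => [|l t _ [tf t_dig t_dom]].
    by split=> // v; exists v => //; exists [::].
  have [tf' t_sub t_die t_eq] := sift_phase l tf.
  move: (exec _ _ _ _) tf' t_sub t_die t_eq => t' tf' t_sub t_die t_eq.
  have dB v j : dig j v < B by rewrite ltn_pmod.
  split=> // [u v j uv ut vt|v].
    rewrite ltnS leq_eqVlt => /orP[/eqP ->|]; last first.
      by apply: t_dig => //; apply: t_sub.
    by apply/eqP; rewrite eqn_leq !t_eq // e_sym.
  have [w wt [p [wp pv pl]]] := t_dom v.
  case wt': (alive (t' w)); first by exists w => //; exists p; split=> //; lia.
  have [_ [u [uw ut _]]] := t_die w wt (negbT wt').
  by exists u => //; exists (w :: p); rewrite /= uw.
move: (exec _ _ _ _) => t [_ t_dig t_dom]; split=> [u v|v]; last first.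
  by have [w wt wv] := t_dom v; exists w; rewrite ?inE.
rewrite !inE => ut vt; apply/negP => uv; apply: (f_prop u v uv).
by apply: eq_digits (f_lt u) (f_lt v) _ => j; apply: t_dig.
Qed.

End Sift.

End Phases.

(** * Iterated logarithms and the length of Linial's colors *)

Definition tower (k : nat) : nat := iter k (expn 2) 1.

Lemma le_tower_log2 (R : realType) k (x : R) :
  (iter k (@log2 R) x <= 1)%R -> (x <= (tower k)%:R)%R.
Proof.
elim: k x => [|k IH] x //; rewrite iterSr => /IH; rewrite /log2 => xk.
have [x0|x0] := ltrP 0%R x; last by rewrite (le_trans x0) ?ler0n.
have ln2 : (0 < ln 2 :> R)%R by rewrite ln_gt0 // ltr1n.
rewrite -ler_ln ?posrE ?ltr0n ?expn_gt0 // natrX lnXn //.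
by rewrite -[leRHS]mulr_natl -ler_pdivrMr.
Qed.

Lemma le_tower_log_star (R : realType) n : n <= tower (log_star R n).
Proof.
rewrite /log_star; case: ex_minnP => k nk _.
by have := le_tower_log2 nk; rewrite ler_nat.
Qed.

(** Rounding logarithms up costs no extra iteration, because the exponents in a tower are
    integers. *)
Lemma iter_up_log_tower k n : n <= tower k -> iter k (up_log 2) n <= 1.
Proof.
elim: k n => [|k IH] n //; rewrite iterSr => nk; apply: IH.
exact: up_log_min.
Qed.

Fixpoint linial_bits (c n Delta i : nat) : nat :=
  if i is j.+1 then 2 * up_log 2 ((linial_bits c n Delta j).+1 * Delta).+1
  else c * up_log 2 n.

(** One constant serves all [i], since only its logarithm [c + 4] enters the next length;
    [2 * c + 16 <= 2 ^ (c + 4)] absorbs the additive terms. *)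
Lemma linial_bits_le c n Delta i : 0 < Delta ->
  linial_bits c n Delta i
    <= 2 ^ (c + 4) * (iter i.+1 (up_log 2) n + (up_log 2 Delta).+1).
Proof.
move=> D0; have c_lt : c < 2 ^ c by exact: ltn_expl.
have K_ge : 2 * c + 16 <= 2 ^ (c + 4) by rewrite expnD; lia.
have [K KE] : exists K, K = 2 ^ (c + 4) by exists (2 ^ (c + 4)).
rewrite -KE in K_ge *.
elim: i => [|i IH] /=; first by nia.
set L := linial_bits c n Delta i in IH *.
move: IH; rewrite iterS; set u := up_log 2 _; set d := (up_log 2 Delta).+1 => IH.
have D_le : Delta <= 2 ^ up_log 2 Delta by exact: up_logP.
have u_le : u <= 2 ^ up_log 2 u by exact: up_logP.
have d_lt : d < 2 ^ d by exact: ltn_expl.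
have A0 : 0 < 2 ^ up_log 2 u by rewrite expn_gt0.
have ud : u + d <= 2 ^ up_log 2 u * 2 ^ d by nia.
have L1 : L.+1 <= 2 * (2 ^ (c + 4) * (2 ^ up_log 2 u * 2 ^ d)).
  rewrite -KE; have : K * (u + d) <= K * (2 ^ up_log 2 u * 2 ^ d).
    by rewrite leq_mul2l ud orbT.
  have : 0 < K * (u + d) by rewrite muln_gt0 addnS andbT; lia.
  lia.
have: (L.+1 * Delta).+1 <= 2 ^ (2 + (c + 4) + up_log 2 u + d + up_log 2 Delta).
  apply: (@leq_trans (2 * (L.+1 * Delta))).
    by rewrite mul2n -addnn -[X in X <= _]addn1 leq_add2l muln_gt0.
  rewrite !expnD mulnA; apply: leq_mul => //.
  by apply: leq_trans (leq_mul (leqnn 2) L1) _; rewrite expnD; lia.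
move=> /(up_log_min (isT : 1 < 2)).
by rewrite /d; nia.
Qed.

Lemma up_log_leq n : up_log 2 n <= n.
Proof. by rewrite up_log_min // ltnW // ltn_expl. Qed.

(** * The complete list of rounds, its length and its correctness *)

Section Assembly.

(** The classes and the final colors come from grids of sides [2 ^ (s + 2 * a)]
   and [2 ^ (s + r * a)], where [2 ^ a] is about [Delta ^ (1 / (r + 2))], and the
   curves have degree at most [N.+1]. *)
Variables (r c n Delta N s a : nat).

Definition ruling_rounds (T : nat) : seq (round vertex_state) :=
  if Delta == 0 then [::] else
  flatten [seq [:: linial_round
      (up_log 2 ((linial_bits c n Delta i).+1 * Delta).+1)
      (linial_bits c n Delta i)] | i <- iota 0 T] ++
  learn_round ::
  flatten [seq [:: class_round (s + 2 * a) N (Delta %/ 2 ^ (2 * a)) x]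
          | x <- iota 0 (2 ^ (s + 2 * a))] ++
  flatten [seq [:: shift_round (s + r * a) N Delta; final_round (s + r * a) N x]
          | x <- iota 0 (2 ^ (s + 2 * a))] ++
  sift_rounds (2 ^ (2 * (s + a))) r.

Lemma size_ruling_rounds T :
  size (ruling_rounds T) =
    if Delta == 0 then 0
    else T + (1 + 3 * 2 ^ (s + 2 * a) + r * 2 ^ (2 * (s + a))).
Proof.
rewrite /ruling_rounds; case: eqP => // _.
rewrite size_cat /= !size_cat /sift_rounds.
rewrite (size_loop (k := 1)) // (size_loop (k := 1)) // (size_loop (k := 2)) //.
rewrite (size_loop (k := 2 ^ (2 * (s + a)))); first by lia.
by move=> i; rewrite (size_loop (k := 1)) // muln1.
Qed.

Variables (V : finType) (e : rel V) (ports : V -> seq V) (id : V -> nat).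
Variables (T bits : nat).
Hypotheses (r_ge2 : 2 <= r) (e_simple : simple_graph e).
Hypotheses (portsP : port_numbering e ports) (idP : identifiers c id).
Hypotheses (nE : n = #|V|) (DeltaE : Delta = max_degree e).

Lemma ports_size v : size (ports v) <= Delta.
Proof.
have [p_uniq p_mem] := portsP v; rewrite -(card_uniqP p_uniq).
rewrite (eq_card (B := mem [set u | e v u])).
  by rewrite DeltaE /max_degree (leq_bigmax v).
by move=> u; rewrite inE -p_mem.
Qed.

Lemma max_degree_le_card : Delta <= n.
Proof. by rewrite DeltaE; apply/bigmax_leqP => v _; rewrite nE max_card. Qed.

Lemma card_gt1_of_degree : 0 < Delta -> 1 < n.
Proof.
move=> D0; have [v _ vD] : exists2 v, v \in V & 0 < #|[set u | e v u]|.
  apply/exists_inP; apply: contraTT D0; rewrite negb_exists_in DeltaE -eqn0Ngt.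
  move=> /forall_inP nov; rewrite -leqn0; apply/bigmax_leqP => v _.
  by have := nov v isT; rewrite lt0n negbK => /eqP ->.
have /card_gt0P[u] := vD; rewrite inE => vu; have [_ e_irr] := e_simple.
rewrite nE -cardsT (@leq_trans #|[set u; v]|) ?subset_leq_card ?subsetT //.
by rewrite cards2; case: eqP => // uv; rewrite uv e_irr in vu.
Qed.

Lemma ruling_rounds_correct0 : Delta = 0 ->
  ruling_set2 e r
    [set v | alive (exec ports bits (ruling_rounds T) (fun v => start (id v)) v)].
Proof.
rewrite /ruling_rounds => D0; rewrite D0 eqxx /=.
split=> [u v _ _|v]; last by exists v; rewrite ?inE //; exists [::].
have := ports_size u; rewrite D0 leqn0 size_eq0 => /eqP pu.
by have [_ <-] := portsP u; rewrite pu.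
Qed.

Hypothesis Delta_gt0 : 0 < Delta.
Hypotheses (a_big : up_log 2 Delta <= r.+2 * a) (s_big : 2 * N.+1 <= 2 ^ s).
Hypothesis N_gt0 : 0 < N.
Hypothesis linial_fits : forall i, linial_bits c n Delta i <= bits.
Hypothesis linial_end : linial_bits c n Delta T <= a * N.
Hypothesis class_fits : s + 2 * a < bits.
Hypothesis final_fits : 2 * (s + r * a) < bits.

Lemma ruling_rounds_correct :
  ruling_set2 e r
    [set v | alive (exec ports bits (ruling_rounds T) (fun v => start (id v)) v)].
Proof.
have [e_sym e_irr] := e_simple; have [id_inj id_lt] := idP.
rewrite /ruling_rounds (negPf (lt0n_neq0 Delta_gt0)).
have exp0 m : 0 < 2 ^ m by rewrite expn_gt0.
have s0 : 0 < s by case: s s_big => //; lia.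
have D_le : Delta <= 2 ^ (r.+2 * a).
  by apply: leq_trans (up_logP Delta (isT : 1 < 2)) _; rewrite leq_exp2l.
have colors_fit k : a <= k -> 2 ^ linial_bits c n Delta T <= (2 ^ k) ^ N.
  move=> ak; rewrite -expnM leq_exp2l // (leq_trans linial_end) //.
  by rewrite leq_mul2r ak orbT.
rewrite exec_cat exec_cons !exec_cat.
have [] := @linial_phase V e ports bits Delta portsP ports_size
  (fun i => up_log 2 ((linial_bits c n Delta i).+1 * Delta).+1)
  (linial_bits c n Delta) T (fun v => start (id v)).
- move=> i _; split=> //; first by rewrite up_log_gt0 !ltnS muln_gt0 Delta_gt0.
  exact: up_logP.
- split=> [u v uv|v] /=; last by rewrite nE; apply: id_lt.
  by apply/eqP => /id_inj uv'; rewrite uv' e_irr in uv.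
- by [].
move: (exec _ _ _ _) => t1 t1_prop t1_un.
have [|t2_inf t2_none] := learn_phase ports (b := bits) _ t1_prop t1_un.
  by rewrite leq_exp2l.
move: (apply_round _ _ _ _) t2_inf t2_none => t2 t2_inf t2_none.
have r2a : r.+2 * a = r * a + 2 * a by rewrite -[r.+2]addn2 mulnDl.
have beta_le : Delta %/ 2 ^ (2 * a) <= 2 ^ (r * a).
  by rewrite (leq_trans (leq_div2r _ D_le)) // r2a expnD mulnK.
(* Here [r >= 2] is used, in the form [2 * a <= s + r * a]. *)
have taken_le : Delta %/ 2 ^ (s + r * a) <= 2 ^ (r * a).
  rewrite -ltnS ltn_divLR // (leq_ltn_trans D_le) // r2a expnD.
  apply: (@leq_ltn_trans (2 ^ (r * a) * 2 ^ (s + r * a))).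
    rewrite leq_mul2l leq_exp2l // (leq_trans _ (leq_addl _ _)) ?orbT //.
    by rewrite leq_mul2r r_ge2 orbT.
  by rewrite ltn_mul2r exp0 ltnSn.
have class_few : 2 * N.+1 * Delta < (Delta %/ 2 ^ (2 * a)).+1 * 2 ^ (s + 2 * a).
  rewrite expnD mulnCA; apply: (@leq_ltn_trans (2 ^ s * Delta)).
    by rewrite leq_mul2r s_big orbT.
  by rewrite ltn_mul2l exp0 ltn_ceil.
have class_lt : 2 ^ (s + 2 * a) < 2 ^ bits by rewrite ltn_exp2l.
have s0a m : 0 < s + m by rewrite addn_gt0 s0.
have class_colors : a <= s + 2 * a by lia.
have := class_phase e_sym portsP ports_size class_lt (s0a _) class_few
  (colors_fit _ class_colors) t2_inf t2_none.
move: (exec _ _ _ _) => t3 t3_arb.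
have final_few :
    Delta %/ 2 ^ (s + r * a) + N.+1 * (Delta %/ 2 ^ (2 * a)) < 2 ^ (s + r * a).
  (* The sum is at most [N.+2 * 2 ^ (r * a)], and [N.+2 < 2 * N.+1 <= 2 ^ s] as [N] is positive. *)
  apply: leq_ltn_trans (leq_add taken_le (leq_mul (leqnn N.+1) beta_le)) _.
  by rewrite -mulSn expnD ltn_mul2r exp0 /=; lia.
have final_colors : a <= s + r * a.
  by rewrite (leq_trans _ (leq_addl _ _)) // leq_pmull // ltnW.
have := final_phase e_sym portsP ports_size final_fits (s0a _)
  (colors_fit _ final_colors) final_few t3_arb.
move: (exec _ _ _ _) => t4 [[_ _ [t4_class _] t4_some]].
case=> t4_alive t4_done t4_lt t4_prop.
have fin v : exists2 f, final (t4 v) = Some f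
    & f < 2 ^ (s + r * a) * 2 ^ (s + r * a).
  case fv: (final (t4 v)) => [f|]; first by exists f => //; apply: t4_lt fv.
  have := t4_done v; rewrite fv /class_number; have := t4_some v.
  by case cv: (class (t4 v)) => [k|] //= _; have [-> _ _] := t4_class _ _ cv.
apply: (@sift_ruling_set V e ports bits e_sym portsP _
  (fun v => odflt 0 (final (t4 v)))) => //.
- exact: leq_ltn_trans class_fits.
- move=> v; have [f -> /= f_lt] := fin v; apply: leq_trans f_lt _.
  (* [r] digits suffice because [s + r * a <= r * (s + a)]. *)
  rewrite -expnD -expnM leq_exp2l //; nia.
- move=> u v uv; have [f fu _] := fin u; have [g gv _] := fin v.
  by rewrite fu gv /= => fg; apply: (t4_prop u v f uv fu); rewrite gv fg.
Qed.

End Assembly.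

(** * Choice of the parameters and the bound on the number of rounds *)

Definition scale (r Delta : nat) : nat := (up_log 2 Delta %/ r.+2).+1.

Lemma ruling_parameters r c :
  exists N s bf : nat, [/\ 0 < N, 2 * N.+1 <= 2 ^ s
    & forall n Delta T, 0 < Delta -> Delta <= n -> 1 < n ->
      iter T (up_log 2) n <= 1 ->
      let a := scale r Delta in
      let bits := bf * up_log 2 n in
      [/\ up_log 2 Delta <= r.+2 * a,
          forall i, linial_bits c n Delta i <= bits,
          linial_bits c n Delta T <= a * N,
          s + 2 * a < bits
        & 2 * (s + r * a) < bits]].
Proof.
have [K KE] : exists K, K = 2 ^ (c + 4) by exists (2 ^ (c + 4)).
have K0 : 0 < K by rewrite KE expn_gt0.
(* After the last Linial round the iterated logarithm is 0, so the length is at most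
   [K * (up_log 2 Delta).+1 <= a * N]. In the bandwidth, [3 * K] is for Linial's colors and the rest
   for grid points and shifts. *)
pose N := r.+2 * K; exists N, N.+2, (3 * K + (2 * N.+2 + 4 * r + 5)).
split=> [||n Delta T D0 Dn n2 Tn a bits]; first by rewrite muln_gt0.
  by rewrite expnS leq_mul2l /= ltnW // ltn_expl.
have u1 : 0 < up_log 2 n by rewrite up_log_gt0.
have Du : up_log 2 Delta <= up_log 2 n by apply: leq_up_log.
have aD : up_log 2 Delta < r.+2 * a by rewrite /a mulnC ltn_ceil.
have a_le : a <= (up_log 2 Delta).+1 by rewrite ltnS leq_div.
have iter_le i : iter i.+1 (up_log 2) n <= up_log 2 n.
  by elim: i => // i IH; rewrite iterS (leq_trans (up_log_leq _)).
have [s_fits r_fits] : N.+2 + 2 * a < bits /\ 2 * (N.+2 + r * a) < bits.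
  have: (2 * N.+2 + 4 * r + 5) * up_log 2 n <= bits.
    by rewrite leq_mul2r leq_addl orbT.
  move: (N.+2) (up_log 2 n) (up_log 2 Delta) a a_le bits u1 Du {aD iter_le}.
  move=> s u d a ad bits u1 du bits_ge.
  have s_le : s <= s * u by rewrite leq_pmulr.
  have r_le : r <= r * u by rewrite leq_pmulr.
  have ra_le : r * a <= r * u + r by rewrite addnC -mulnS leq_mul2l; lia.
  by nia.
split=> //; first exact: ltnW.
- move=> i; apply: leq_trans (linial_bits_le c n i D0) _; rewrite -KE.
  apply: (@leq_trans (K * (3 * up_log 2 n))).
    rewrite leq_mul2l; apply/orP; right.
    by move: (iter_le i); move: (iter _ _ _) => x; lia.
  by rewrite mulnA leq_mul2r [K * 3]mulnC leq_addr orbT.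
- apply: leq_trans (linial_bits_le c n T D0) _; rewrite -KE iterS.
  have /eqP -> : up_log 2 (iter T (up_log 2) n) == 0.
    by rewrite up_log_eq0 Tn orbT.
  by rewrite /N mulnA [a * _]mulnC mulnC leq_mul2r aD orbT.
Qed.

(** Raising to the power [r.+2] keeps the exponents integral. Rounding the logarithm costs a factor
    2 and rounding [scale] a factor [2 ^ r.+2]; the square of their product is at most
    [16 ^ r.+2]. *)
Lemma expn_scale_le r Delta :
  0 < Delta -> 2 ^ (2 * scale r Delta * r.+2) <= 16 ^ r.+2 * Delta ^ 2.
Proof.
move=> D0.
have D_le : 2 ^ up_log 2 Delta <= 2 * Delta.
  have [D1|D1] := leqP Delta 1; first by have -> : Delta = 1 by lia.
  rewrite -(prednK (n := up_log 2 Delta)) ?up_log_gt0 // expnS leq_mul2l /=.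
  by rewrite ltnW // up_log_gtn.
have a_le : scale r Delta * r.+2 <= up_log 2 Delta + r.+2.
  by rewrite /scale mulSn addnC leq_add2r leq_divM.
apply: (@leq_trans ((2 ^ (up_log 2 Delta + r.+2)) ^ 2)).
  by rewrite -expnM leq_exp2l // -mulnA mulnC leq_mul2r a_le orbT.
apply: (@leq_trans ((2 ^ r.+3 * Delta) ^ 2)).
  rewrite leq_exp2r // expnD (expnSr 2 r.+2) -mulnA [leqLHS]mulnC.
  by rewrite leq_mul2l D_le orbT.
rewrite expnMn leq_mul2r -expnM -[16]/(2 ^ 4) -expnM leq_exp2l //.
by apply/orP; right; lia.
Qed.

Lemma scale_le_powR (R : realType) r Delta : 0 < Delta ->
  ((2 ^ (2 * scale r Delta))%:R <= 16 * Delta%:R `^ (2 / (r%:R + 2)) :> R)%R.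
Proof.
move=> D0; rewrite -(@ler_pXn2r _ r.+2) ?nnegrE ?mulr_ge0 ?powR_ge0 //.
rewrite exprMn -[X in (_ * X)%R]powR_mulrn ?powR_ge0 // -powRrM.
have -> : (2 / (r%:R + 2) * r.+2%:R = 2%:R :> R)%R.
  by rewrite -[r.+2]addn2 natrD divfK // -natrD pnatr_eq0 addn2.
rewrite powR_mulrn // -!natrX -natrM ler_nat -expnM.
exact: expn_scale_le.
Qed.

Local Open Scope ring_scope.

Theorem theorem4 (R : realType) (r : nat) (hr : (2 <= r)%N) (c : nat) :
  exists (b : nat) (C : R)
    (A : forall n Delta : nat, congest_algorithm (b * up_log 2 n)%N),
  forall (V : finType) (e : rel V) (ports : V -> seq V) (id : V -> nat),
    simple_graph e ->
    port_numbering e ports ->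
    identifiers c id ->
    exists (T : nat) (S : {set V}),
      [/\ T%:R <= C * ((max_degree e)%:R `^ (2 / (r%:R + 2)))
                  + (log_star R #|V|)%:R,
          computes_in (A #|V| (max_degree e)) ports id T S
        & ruling_set2 e r S].
Proof.
have [N [s [bf [N0 s_big paramP]]]] := ruling_parameters r c.
(* 16 comes from [scale_le_powR]; the second factor counts the learning round, three rounds per
   class and [r] loops over digits, in units of [2 ^ (2 * a)]. *)
exists bf, (16 * (1 + 3 * 2 ^ s + r * 2 ^ (2 * s))%N%:R).
exists (fun n Delta => broadcast_algorithm (bf * up_log 2 n)%N
  (ruling_rounds r c n Delta N s (scale r Delta) (log_star R n))
  (fun id _ => start id) alive).
move=> V e ports id e_simple portsP idP.
set n := #|V|; set Delta := max_degree e; set a := scale r Delta.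
set T := log_star R n; set bits := (bf * up_log 2 n)%N.
set rs := ruling_rounds r c n Delta N s a T.
exists (size rs).
exists [set v | alive (exec ports bits rs (fun v => start (id v)) v)].
split; first 1 last.
- exact: broadcast_computes.
- have [D0|D0] := posnP Delta; first exact: ruling_rounds_correct0.
  have n2 : (1 < n)%N.
    exact: (card_gt1_of_degree e_simple (erefl n) (erefl Delta)).
  have Dn : (Delta <= n)%N by exact: (max_degree_le_card (erefl n) (erefl Delta)).
  have Tn : (iter T (up_log 2) n <= 1)%N.
    by apply: iter_up_log_tower; apply: le_tower_log_star.
  have [a_big lb_le lb_end s_fits r_fits] := paramP n Delta T D0 Dn n2 Tn.
  exact: (ruling_rounds_correct hr e_simple portsP idP (erefl n) (erefl Delta)
            D0 a_big s_big N0 lb_le lb_end s_fits r_fits).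
rewrite size_ruling_rounds; case: eqP => [_|/eqP]; first by
  rewrite addr_ge0 ?mulr_ge0 ?powR_ge0 ?ler0n.
(* Each Linial iteration takes a single round, so [log_star] cancels with coefficient exactly 1. *)
rewrite -lt0n => D0; rewrite addnC natrD lerD2r.
have := scale_le_powR R r D0; set y := (_ `^ _); rewrite -/a => a_le.
rewrite mulrAC; apply: le_trans (ler_wpM2r (ler0n _ _) a_le).
rewrite -natrM ler_nat.
have p0 : (0 < 2 ^ (2 * a))%N by rewrite expn_gt0.
rewrite expnD [(2 * (s + a))%N]mulnDr expnD.
by move: (2 ^ (2 * a))%N (2 ^ s)%N (2 ^ (2 * s))%N p0 => g S S' p0; nia.
Qed.
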